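(* Let $\mathcal{C}$ be a small category with finite limits, equipped with an admissible class $\mathcal{M}$, with associated presheaf $M$. For any $C\in\mathcal{C}$, $f\in M(C)$ and $S_C\in\Omega(C)$, one has $(j_M)_C(S_C\cdot f)\subseteq(j_M)_C(S_C)\cdot f$. The converse holds, i.e. $j_M$ is $M$-action preserving, whenever in $\mathcal{C}$ every composable pair $(s,t)$, $s:D\to E$, $t:E\to F$, with $s\in\mathcal{M}$ admits a pullback with $h\in\mathcal{M}$, in the sense that there exist an object $P$ and arrows $k:D\to P$ and $h:P\to F$ with $h\in\mathcal{M}$ such that the square $hk=ts$ is a pullback square (exhibiting $D$ as the pullback of $h$ and $t$). Similarly, $j_{\mathrm{Sub}}$ is $M$-action preserving if the same condition holds with the class of monics of $\mathcal{C}$ in place of $\mathcal{M}$ (i.e. for every composable pair $(s,t)$ with $s$ monic there is such a pullback square with $h$ monic).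
   Context: $\widehat{\mathcal{C}}$ is the category of presheaves of sets on $\mathcal{C}$, with subobject classifier $\Omega$: $\Omega(C)$ is the set of sieves on $C$. For an arrow $f$, $D_f$ is its domain and $C_f$ its codomain. For arrows $f,g$ with codomain $C$, $f\times g$ denotes their product in the slice category $\mathcal{C}/C$, i.e. the diagonal of the pullback square of $f$ and $g$. An admissible class $\mathcal{M}$ on $\mathcal{C}$ is a family of subobjects (monics) of $\mathcal{C}$ which contains all identities, is closed under composition, and is closed under pullback along arbitrary arrows. It yields a subpresheaf $M$ of $\mathrm{Sub}_{\mathcal{C}}(-):\mathcal{C}^{\mathrm{op}}\to\mathbf{Sets}$ by $M(C)=\mathcal{M}/C$, the set of subobjects of $C$ in $\mathcal{M}$, with arrows acting by pullback. $M$ is an internal commutative monoid with multiplication $f\times g$ and unit $\mathrm{id}_C$ at each $C$, and it acts on $\Omega$ by $$S_C\cdot f=\{h\mid C_h=C,\ f\times h\in S_C\}\qquad (S_C\in\Omega(C),\ f\in M(C)).$$ A map $\phi:\Omega\to\Omega$ in $\widehat{\mathcal{C}}$ is $M$-action preserving if $\phi_C(S_C\cdot f)=\phi_C(S_C)\cdot f$ for all $C$, $S_C\in\Omega(C)$, $f\in M(C)$. The topology $j_M:\Omega\to\Omega$ is given by $(j_M)_C(S_C)=\{f\mid C_f=C,\ \exists g\in\mathcal{M}/D_f;\ fg\in S_C\}$, and $j_{\mathrm{Sub}}$ is the topology given by the same formula with $\mathcal{M}$ replaced by the class of all monics of $\mathcal{C}$: $(j_{\mathrm{Sub}})_C(S_C)=\{f\mid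 C_f=C,\ \exists g\in\mathrm{Sub}_{\mathcal{C}}(D_f);\ fg\in S_C\}$. *)

(* Defs.v *)
From mathcomp Require Import all_boot.
From mathcomp Require Import boolp classical_sets functions cardinality.

Set Implicit Arguments.
Unset Strict Implicit.
Unset Printing Implicit Defensive.

Declare Scope cat_scope.
Delimit Scope cat_scope with cat.
Local Open Scope cat_scope.

Record category := Category {
  ob :> Type;
  hom : ob -> ob -> Type;
  idm : forall A, hom A A;
  comp : forall A B D, hom B D -> hom A B -> hom A D;
  comp1m : forall A B (f : hom A B), comp (idm B) f = f;
  compm1 : forall A B (f : hom A B), comp f (idm A) = f;
  compA : forall A B D E (h : hom D E) (g : hom B D) (f : hom A B),
    comp h (comp g f) = comp (comp h g) f
}.
Arguments hom {c} _ _.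
Arguments idm {c} A.
Arguments comp {c A B D} _ _.

Notation "g \o f" := (comp g f) : cat_scope.

Record functor (J C : category) := Functor {
  fob :> J -> C;
  fmap : forall i j : J, hom i j -> hom (fob i) (fob j);
  fmap1 : forall i, fmap (idm i) = idm (fob i);
  fmapM : forall (i j k : J) (v : hom j k) (u : hom i j),
    fmap (v \o u) = fmap v \o fmap u
}.
Arguments fmap {J C} f {i j} _.

Record cone (J C : category) (F : functor J C) := Cone {
  apex : C;
  leg : forall j : J, hom apex (F j);
  leg_nat : forall (i j : J) (u : hom i j), fmap F u \o leg i = leg j
}.

Definition is_limit (J C : category) (F : functor J C) (L : cone F) : Prop :=
  forall K : cone F,
    exists! u : hom (apex K) (apex L), forall j, leg L j \o u = leg K j.

Definition finite_category (J : category) : Prop :=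
  finite_set [set: ob J] /\ forall i j : J, finite_set [set: hom i j].

Definition has_finite_limits (C : category) : Prop :=
  forall (J : category) (F : functor J C),
    finite_category J -> exists L : cone F, is_limit L.

(* Smallness is automatic: [ob C] and [hom A B] are types. *)
Record lexCategory := LexCategory {
  lex_cat :> category;
  lexP : has_finite_limits lex_cat
}.

Section Pullbacks.
Context {C : category}.

Definition is_pullback (A B X P : C) (f : hom A X) (g : hom B X)
    (p : hom P A) (q : hom P B) : Prop :=
  f \o p = g \o q /\
  forall (W : C) (a : hom W A) (b : hom W B), f \o a = g \o b ->
    exists! u : hom W P, p \o u = a /\ q \o u = b.

Definition monic (A B : C) (m : hom A B) : Prop :=
  forall (W : C) (a b : hom W A), m \o a = m \o b -> a = b.

Record pullback (A B X : C) (f : hom A X) (g : hom B X) := Pullback {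
  pb_ob : C;
  pb_fst : hom pb_ob A;
  pb_snd : hom pb_ob B;
  pb_is : is_pullback f g pb_fst pb_snd
}.

End Pullbacks.

Inductive cospan_ob := cosL | cosR | cosM.

Definition cospan_hom (i j : cospan_ob) : Type :=
  match i, j with
  | cosL, cosL | cosR, cosR | cosM, cosM | cosL, cosM | cosR, cosM => unit
  | _, _ => void
  end.

Definition cospan_id (i : cospan_ob) : cospan_hom i i.
Proof. by case: i; exact: tt. Defined.

Definition cospan_comp (i j k : cospan_ob) :
  cospan_hom j k -> cospan_hom i j -> cospan_hom i k.
Proof. by case: i j k => [] [] [] //= [] []. Defined.

Lemma cospan_homI (i j : cospan_ob) (u v : cospan_hom i j) : u = v.
Proof. by case: i j u v => [] [] //= [] []. Qed.

Definition cospan : category :=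
  @Category cospan_ob cospan_hom cospan_id cospan_comp
    (fun _ _ _ => cospan_homI _ _) (fun _ _ _ => cospan_homI _ _)
    (fun _ _ _ _ _ _ _ => cospan_homI _ _).

Lemma cospan_finite : finite_category cospan.
Proof.
split; last by case=> [] [] /=; exact: finite_finset.
apply: (@sub_finite_set _ _
  ((fun o : option bool =>
      if o is Some b then (if b then cosL else cosR) else cosM) @` setT)).
  by case=> _ /=; [exists (Some true)|exists (Some false)|exists None].
exact/finite_image/finite_finset.
Qed.

Section CospanDiagram.
Context {C : category} (A B X : C) (f : hom A X) (g : hom B X).

Definition cospan_fob (i : cospan) : C :=
  match i with cosL => A | cosR => B | cosM => X end.

Definition cospan_fmap (i j : cospan) :
  hom i j -> hom (cospan_fob i) (cospan_fob j) :=
  match i, j return cospan_hom i j -> hom (cospan_fob i) (cospan_fob j) with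
  | cosL, cosL => fun=> idm A
  | cosR, cosR => fun=> idm B
  | cosM, cosM => fun=> idm X
  | cosL, cosM => fun=> f
  | cosR, cosM => fun=> g
  | _, _ => fun v => match v with end
  end.

Lemma cospan_fmap1 (i : cospan) : cospan_fmap (idm i) = idm (cospan_fob i).
Proof. by case: i. Qed.

Lemma cospan_fmapM (i j k : cospan) (v : hom j k) (u : hom i j) :
  cospan_fmap (v \o u) = cospan_fmap v \o cospan_fmap u.
Proof. by case: i j k v u => [] [] [] [] [] /=; rewrite ?comp1m ?compm1. Qed.

Definition cospan_diagram : functor cospan C :=
  Functor cospan_fmap1 cospan_fmapM.

Section ConeOfSquare.
Context (W : C) (a : hom W A) (b : hom W B) (ab : f \o a = g \o b).

Definition cospan_leg (i : cospan) : hom W (cospan_fob i) :=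
  match i with cosL => a | cosR => b | cosM => f \o a end.

Lemma cospan_leg_nat (i j : cospan) (u : hom i j) :
  cospan_fmap u \o cospan_leg i = cospan_leg j.
Proof. by case: i j u => [] [] [] /=; rewrite ?comp1m. Qed.

Definition cospan_cone : cone cospan_diagram :=
  @Cone cospan C cospan_diagram W cospan_leg cospan_leg_nat.

End ConeOfSquare.
End CospanDiagram.

Lemma lex_pullback (C : lexCategory) (A B X : C) (f : hom A X) (g : hom B X) :
  inhabited (pullback f g).
Proof.
have [L limL] := lexP (cospan_diagram f g) cospan_finite.
have fL : f \o leg L cosL = leg L cosM.
  exact: (leg_nat L (tt : @hom cospan cosL cosM)).
have gL : g \o leg L cosR = leg L cosM.
  exact: (leg_nat L (tt : @hom cospan cosR cosM)).
constructor; exists (apex L) (leg L cosL) (leg L cosR); split.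
  by rewrite fL.
move=> W a b ab; have [u [uP uniq_u]] := limL (cospan_cone ab).
exists u; split=> [|v [va vb]].
  by split; [exact: (uP cosL)|exact: (uP cosR)].
apply: uniq_u => -[] //=.
by rewrite -fL -compA va.
Qed.

Section SliceProduct.
Context {C : lexCategory} (A B X : C) (f : hom A X) (g : hom B X).

Definition the_pullback : pullback f g :=
  inhabited_witness (lex_pullback f g).

Definition slice_prod : hom (pb_ob the_pullback) X :=
  f \o pb_fst the_pullback.

End SliceProduct.

Record presheaf (C : category) := Presheaf {
  psh :> C -> Type;
  res : forall A B : C, hom A B -> psh B -> psh A;
  res1 : forall (A : C) (x : psh A), res (idm A) x = x;
  resM : forall (A B D : C) (g : hom B D) (f : hom A B) (x : psh D),
    res (g \o f) x = res f (res g x)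
}.
Arguments res {C} p {A B} _ _.

Record presheaf_map (C : category) (F G : presheaf C) := PresheafMap {
  pmap :> forall X : C, F X -> G X;
  pmap_nat : forall (A B : C) (f : hom A B) (x : F B),
    pmap (res F f x) = res G f (pmap x)
}.

Record sieve (C : category) (X : C) := Sieve {
  mem_sieve : forall D : C, hom D X -> Prop;
  sieve_closed : forall (D E : C) (h : hom D X) (k : hom E D),
    mem_sieve h -> mem_sieve (h \o k)
}.
Arguments mem_sieve {C X} _ {D} _.

Definition sub_sieve (C : category) (X : C) (S T : sieve X) : Prop :=
  forall (D : C) (h : hom D X), mem_sieve S h -> mem_sieve T h.

Section Omega.
Context {C : category}.

Lemma sieve_ext (X : C) (S T : sieve X) :
  sub_sieve S T -> sub_sieve T S -> S = T.
Proof.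
case: S T => [S clS] [T clT] /= ST TS.
have eqST : S = T.
  apply: functional_extensionality_dep => D; apply/funext => h.
  by apply/propext; split; [exact: ST|exact: TS].
by case: _ / eqST in clT ST TS *; rewrite (Prop_irrelevance clS clT).
Qed.

Definition sieve_res (A B : C) (f : hom A B) (S : sieve B) : sieve A.
Proof.
exists (fun D (h : hom D A) => mem_sieve S (f \o h)).
by move=> D E h k Sh; rewrite compA; exact: sieve_closed.
Defined.

Lemma sieve_res1 (A : C) (S : sieve A) : sieve_res (idm A) S = S.
Proof. by apply: sieve_ext => D h /=; rewrite comp1m. Qed.

Lemma sieve_resM (A B D : C) (g : hom B D) (f : hom A B) (S : sieve D) :
  sieve_res (g \o f) S = sieve_res f (sieve_res g S).
Proof. by apply: sieve_ext => E h /=; rewrite compA. Qed.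

End Omega.

Definition Omega (C : category) : presheaf C :=
  Presheaf (@sieve_res1 C) (@sieve_resM C).

(* Subobjects are given by representing monics: the action of a monic on a
   sieve depends only on the subobject it represents ([act_iso]). Since
   [adm_pullback] is about every pullback square, not only the chosen ones,
   the class is invariant under isomorphism over the codomain (pull back along
   an identity). *)
Record admissible_class (C : category) := AdmissibleClass {
  adm :> forall A B : C, hom A B -> Prop;
  adm_monic : forall (A B : C) (m : hom A B), adm m -> monic m;
  adm_id : forall A : C, adm (idm A);
  adm_comp : forall (A B D : C) (n : hom B D) (m : hom A B),
    adm n -> adm m -> adm (n \o m);
  adm_pullback : forall (A B X P : C) (m : hom A X) (u : hom B X)
      (p : hom P A) (q : hom P B),
    is_pullback m u p q -> adm m -> adm q
}.
Arguments adm {C} _ {A B} _.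

Section Monics.
Context {C : category}.

Lemma monic_id (A : C) : monic (idm A).
Proof. by move=> W a b; rewrite !comp1m. Qed.

Lemma monic_comp (A B D : C) (n : hom B D) (m : hom A B) :
  monic n -> monic m -> monic (n \o m).
Proof. by move=> nM mM W a b; rewrite -!compA => /nM /mM. Qed.

Lemma monic_pullback (A B X P : C) (m : hom A X) (u : hom B X)
    (p : hom P A) (q : hom P B) :
  is_pullback m u p q -> monic m -> monic q.
Proof.
move=> [mp_uq pbP] mM W a b qab.
have pab : p \o a = p \o b by apply: mM; rewrite !compA mp_uq -!compA qab.
have [|v [_ uniq_v]] := pbP W (p \o b) (q \o b).
  by rewrite !compA mp_uq.
by rewrite -(uniq_v a) // -(uniq_v b).
Qed.

End Monics.

Definition monics (C : category) : admissible_class C :=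
  @AdmissibleClass C (@monic C) (fun _ _ _ mM => mM)
    (@monic_id C) (@monic_comp C) (@monic_pullback C).

Section Action.
Context {C : lexCategory}.

(* Membership of [f x h] in a sieve does not depend on the pullback. *)
Lemma slice_prodP (A B X P : C) (S : sieve X) (f : hom A X) (h : hom B X)
    (p : hom P A) (q : hom P B) :
  is_pullback f h p q ->
  mem_sieve S (slice_prod f h) <-> mem_sieve S (f \o p).
Proof.
move=> [fp_hq pbP]; rewrite /slice_prod.
case: (the_pullback f h) => Q r s /= [fr_hs pbQ]; split=> Sm.
  have [u [[<- _] _]] := pbQ _ _ _ fp_hq.
  by rewrite compA; exact: sieve_closed.
have [u [[<- _] _]] := pbP _ _ _ fr_hs.
by rewrite compA; exact: sieve_closed.
Qed.

Definition act (X : C) (S : sieve X) (A : C) (f : hom A X) : sieve X.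
Proof.
exists (fun D (h : hom D X) => mem_sieve S (slice_prod f h)).
move=> D E h k; rewrite /slice_prod.
case: (the_pullback f h) (the_pullback f (h \o k)) =>
  [P p q /= [_ pbP]] [P' p' q' /= [eq' _]] Sfp.
have [|u [[<- _] _]] := pbP _ p' (k \o q'); first by rewrite compA.
by rewrite compA; exact: sieve_closed.
Defined.

Lemma act_iso (X : C) (S : sieve X) (A B : C) (f : hom A X) (g : hom B X)
    (u : hom A B) (v : hom B A) :
  g \o u = f -> f \o v = g -> act S f = act S g.
Proof.
have act_sub A' B' (f' : hom A' X) (g' : hom B' X) (u' : hom A' B') :
    g' \o u' = f' -> sub_sieve (act S g') (act S f').
  move=> gu D h /=; rewrite /slice_prod.
  case: (the_pullback f' h) (the_pullback g' h) =>
    [P p q /= [eqf _]] [P' p' q' /= [_ pbP']] Sgp.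
  have [|w [[wp _] _]] := pbP' _ (u' \o p) q; first by rewrite compA gu.
  by rewrite -gu -compA -wp compA; exact: sieve_closed.
by move=> gu fv; apply: sieve_ext; apply: act_sub; eassumption.
Qed.

Definition action_preserving (M : admissible_class C)
    (phi : presheaf_map (Omega C) (Omega C)) : Prop :=
  forall (X A : C) (f : hom A X) (S : Omega C X), adm M f ->
    phi X (act S f) = act (phi X S) f.

End Action.

Section Topology.
Context {C : lexCategory} (M : admissible_class C).

Definition j_sieve (X : C) (S : sieve X) : sieve X.
Proof.
exists (fun D (f : hom D X) =>
  exists (E : C) (g : hom E D), adm M g /\ mem_sieve S (f \o g)).
move=> D D' f k [E [g [Mg Sfg]]].
have [[P p q pbP]] := lex_pullback g k.
exists P, q; split; first exact: adm_pullback pbP Mg.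
by rewrite -compA -(proj1 pbP) compA; exact: sieve_closed.
Defined.

Lemma j_sieve_nat (A B : C) (f : hom A B) (S : Omega C B) :
  j_sieve (res (Omega C) f S) = res (Omega C) f (j_sieve S).
Proof.
by apply: sieve_ext => D h [E [g [Mg Sg]]]; exists E, g; split=> //;
  move: Sg; rewrite /= compA.
Qed.

Definition j_top : presheaf_map (Omega C) (Omega C) :=
  @PresheafMap C (Omega C) (Omega C) j_sieve j_sieve_nat.

End Topology.

Definition j_Sub (C : lexCategory) : presheaf_map (Omega C) (Omega C) :=
  j_top (monics C).

Definition has_pullback_complements (C : category)
    (M : admissible_class C) : Prop :=
  forall (D E F : C) (s : hom D E) (t : hom E F), adm M s ->
    exists (P : C) (k : hom D P) (h : hom P F),
      adm M h /\ is_pullback h t k s.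

(* Main.v *)
From mathcomp Require Import all_boot.
Require Import Defs.

(** Both inclusions come from pasting squares: for [g : E -> D], pulling [g]
    back along [q], the leg over [D] of the pullback [P] of [f] and [h], gives
    a [g'] into [P] with [f x (h g) = (f x h) g']. Hence a witness [g] in [M]
    yields a witness [g']. Conversely, a witness [g'] into [P] is the pullback
    along [q] of some [g] in [M] by the complement condition on [(g', q)]. *)

Set Implicit Arguments.
Unset Strict Implicit.
Unset Printing Implicit Defensive.

Local Open Scope cat_scope.

Lemma is_pullback_sym (C : category) (A B X P : C) (f : hom A X)
    (g : hom B X) (p : hom P A) (q : hom P B) :
  is_pullback f g p q -> is_pullback g f q p.
Proof.
move=> [fp_gq pbP]; split=> // W b a /esym ab.
have [u [[pu qu] uniq_u]] := pbP W a b ab.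
by exists u; split=> // v [qv pv]; apply: uniq_u.
Qed.

Lemma is_pullback_paste (C : category) (A D E X P Q : C) (f : hom A X)
    (h : hom D X) (g : hom E D) (p : hom P A) (q : hom P D)
    (r : hom Q P) (s : hom Q E) :
  is_pullback f h p q -> is_pullback q g r s ->
  is_pullback f (h \o g) (p \o r) s.
Proof.
move=> [fp_hq pbP] [qr_gs pbQ]; split.
  by rewrite compA fp_hq -!compA qr_gs.
move=> W a b fa_hgb.
have [|v [[pv qv] uniq_v]] := pbP W a (g \o b); first by rewrite compA.
have [u [[ru su] uniq_u]] := pbQ W v b qv.
exists u; split=> [|w [prw sw]]; first by rewrite -compA ru.
(* [r \o w] has the same composites with [p] and [q] as [v], so the two agree. *)
apply: uniq_u; split=> //; apply/esym/uniq_v.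
by rewrite !compA prw qr_gs -compA sw.
Qed.

(** Pasting exhibits [slice_prod f h \o r] as a product of [f] and [h \o g] over [X], and membership
    in [S] does not depend on the pullback chosen to form that product. *)
Lemma mem_act_comp (C : lexCategory) (A D E X Q : C) (S : sieve X)
    (f : hom A X) (h : hom D X) (g : hom E D)
    (r : hom Q (pb_ob (the_pullback f h))) (s : hom Q E) :
  is_pullback (pb_snd (the_pullback f h)) g r s ->
  mem_sieve (act S f) (h \o g) <-> mem_sieve S (slice_prod f h \o r).
Proof.
move=> pbQ; rewrite /slice_prod -compA.
exact: (slice_prodP S (is_pullback_paste (pb_is (the_pullback f h)) pbQ)).
Qed.

Lemma j_top_act_sub (C : lexCategory) (M : admissible_class C) (X A : C)
    (f : hom A X) (S : sieve X) :
  sub_sieve (j_top M X (act S f)) (act (j_top M X S) f).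
Proof.
move=> D h [E [g [Mg Sg]]].
have [[Q s r pbQ]] := lex_pullback g (pb_snd (the_pullback f h)).
exists Q, r; split; first exact: adm_pullback pbQ Mg.
by apply/(mem_act_comp S (is_pullback_sym pbQ)).
Qed.

Lemma j_top_action_preserving (C : lexCategory) (M : admissible_class C) :
  has_pullback_complements M -> action_preserving M (j_top M).
Proof.
move=> complM X A f S _; apply: sieve_ext; first exact: j_top_act_sub.
move=> D h [E [g' [Mg' Sg']]].
(* The new [g] ends at [D], so it can witness that [h] lies in [j_top M X (act S f)]. *)
have [Q [k [g [Mg pbE]]]] := complM _ _ _ g' (pb_snd (the_pullback f h)) Mg'.
exists Q, g; split=> //.
by apply/(mem_act_comp S (is_pullback_sym pbE)).
Qed.

Theorem corollary4p8 (C : lexCategory) (M : admissible_class C) :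
  (forall (X A : C) (f : hom A X) (S : Omega C X), adm M f ->
     sub_sieve (j_top M X (act S f)) (act (j_top M X S) f)) /\
  (has_pullback_complements M -> action_preserving M (j_top M)) /\
  (has_pullback_complements (monics C) -> action_preserving M (j_Sub C)).
Proof.
split; first by move=> X A f S _; exact: j_top_act_sub.
split; first exact: j_top_action_preserving.
move=> complSub X A f S Mf.
(* The class of all monics gives preservation for every monic [f], in particular for those in
   [M]. *)
exact: j_top_action_preserving complSub X A f S (adm_monic Mf).
Qed.
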